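(* Let $\Omega=\Omega(u,v)$ be a solution in $E^4$ of the Betchov-Da Rios equation $\Omega_v=\Omega_u\times\Omega_{uu}\times\Omega_{uuu}$ whose $u$-parameter curves are unit speed, with ED$^2$-frame field $\{T,E,D,N\}$ and associated functions $\kappa,\sigma,\tau$ (notation and standing assumptions as in the context). The soliton surface $S:\Omega=\Omega(u,v)$ is minimal (its mean curvature vector field vanishes identically) if and only if $a_{23}=0$ and $a_{34}=-\kappa^3\tau$ hold, where $$a_{23}=\frac{-1}{\tau\kappa^2}\Big(-3\kappa^3\tau\sigma\sigma_u+\kappa^5\tau_u+2\kappa^4\tau\kappa_u-2\tau\kappa_u^3-\kappa^2\sigma^2(3\kappa\tau_u+5\tau\kappa_u)+2\kappa\kappa_u(\kappa_u\tau_u+2\tau\kappa_{uu})+\kappa^3\tau_{uuu}+\kappa^2(5\kappa_u\tau_{uu}+6\tau_u\kappa_{uu}+2\tau\kappa_{uuu})\Big),$$ $$a_{34}=\frac1\kappa\Big(\big(\kappa\tau\sigma^2-4\kappa_u\tau_u-\kappa\tau_{uu}\big)\kappa-2\big(\kappa_u^2+\kappa\kappa_{uu}\big)\tau\Big).$$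
   Context: $E^4$ is Euclidean 4-space with inner product $\langle\cdot,\cdot\rangle$, and $x\times y\times z$ is the usual alternating ternary vector product of $E^4$ (with a fixed sign convention, e.g. $\langle w,x\times y\times z\rangle=\det(w,x,y,z)$). Subscripts $u,v$ denote partial derivatives. All functions are assumed sufficiently smooth on an open domain of the $(u,v)$-plane. ED$^2$-frame field: for each $v$, the unit speed curve $u\mapsto\Omega(u,v)$ lies on an oriented hypersurface of $E^4$; $T=\Omega_u$ and $N(u,v)$ is the unit normal of the hypersurface at $\Omega(u,v)$. One is in the case where $\{N,T,\Omega_{uu}\}$ is linearly dependent; $E$ is the normalization of $\Omega_{uuu}-\langle\Omega_{uuu},N\rangle N-\langle\Omega_{uuu},T\rangle T$ (assumed nonzero), and $D=N\times T\times E$. Associated functions: $\kappa=\kappa_n=\langle T_u,N\rangle$, $\sigma=\kappa_g^2=\langle E_u,D\rangle$ (the superscript in $\kappa_g^2$ is an index, not a power), $\tau=\tau_g^1=\langle E_u,N\rangle$. The frame satisfies $T_u=\kappa N$, $E_u=\sigma D+\tau N$, $D_u=-\sigma E$, $N_u=-\kappa T-\tau E$. Standing assumption: $\kappa$ and $\tau$ are nowhere zero. The mean curvature vector field of $S$ is $\vec H=\tfrac12(\operatorname{tr}(A_E)E+\operatorname{tr}(A_N)N)$, where $A_E,A_N$ are the shape operators of $S$ with respect to the orthonormal normal frame $\{E,N\}$. *)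

(* Defs.v *)
(* MathComp-Analysis world: R : realType, E^4 = 'rV[R]_4, the (u,v)-plane is
   'rV[R]_2 with u the coordinate of index 0 and v the coordinate of index 1. *)
From HB Require Import structures.
From mathcomp Require Import all_boot all_order all_algebra.
From mathcomp Require Import all_classical all_reals all_analysis.

Set Implicit Arguments.
Unset Strict Implicit.
Unset Printing Implicit Defensive.

Import Order.TTheory GRing.Theory Num.Theory.
Import numFieldNormedType.Exports.

Local Open Scope classical_set_scope.
Local Open Scope ring_scope.

Section EuclideanFourSpace.
Variable R : realType.

(* The library norm `|x| on row vectors is the sup norm, hence a separate
   Euclidean norm (the two define the same topology). *)
Definition dot (x y : 'rV[R]_4) : R := (x *m y^T) 0 0.

Definition enorm (x : 'rV[R]_4) : R := Num.sqrt (dot x x).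

Definition normalize (x : 'rV[R]_4) : 'rV[R]_4 := (enorm x)^-1 *: x.

(* dot w (cross x y z) is the determinant of the matrix with rows w, x, y, z. *)
Definition cross (x y z : 'rV[R]_4) : 'rV[R]_4 :=
  \row_(j < 4) \det (\matrix_(i < 4) [:: delta_mx 0 j; x; y; z]`_i).

End EuclideanFourSpace.

(* C^k on the open set U.  Only used for V of finite dimension, where
   differentiability with all directional derivatives of class C^(k-1) amounts
   to the Frechet derivative being of class C^(k-1). *)
Fixpoint class_C (R : realType) (V W : normedModType R) (k : nat) (U : set V)
    (f : V -> W) : Prop :=
  if k is k'.+1 then
    (forall p, U p -> differentiable f p) /\
    (forall w : V, class_C k' U ('D_w f))
  else forall p, U p -> {for p, continuous f}.

Section Hypersurface.
Variable R : realType.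

Definition grad (f : 'rV[R]_4 -> R) (x : 'rV[R]_4) : 'rV[R]_4 :=
  \row_(i < 4) 'D_(delta_mx 0 i) f x.

(* M is locally a regular level set, and nu is the unit normal of M given by
   the orientation; replacing f by - f gives the opposite orientation. *)
Definition oriented_hypersurface (M : set 'rV[R]_4)
    (nu : 'rV[R]_4 -> 'rV[R]_4) : Prop :=
  forall x, M x -> exists (W : set 'rV[R]_4) (f : 'rV[R]_4 -> R),
    [/\ open W, W x, class_C 1 W f,
        forall y, W y -> (M y <-> f y = 0) &
        forall y, W y -> M y -> grad f y != 0 /\ nu y = normalize (grad f y)].

End Hypersurface.

Section Surface.
Variable R : realType.

Definition pd_u (W : normedModType R) (f : 'rV[R]_2 -> W) : 'rV[R]_2 -> W :=
  'D_(delta_mx 0 0) f.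

Definition pd_v (W : normedModType R) (f : 'rV[R]_2 -> W) : 'rV[R]_2 -> W :=
  'D_(delta_mx 0 1) f.

(* The shape operator A_xi X = - (tangential part of the derivative of xi in
   the direction X), written in the basis (X_u, X_v) of the tangent plane: the
   rows of the Jacobian matrices are partial derivatives, row i of shape_matrix
   lists the coordinates of A_xi of the i-th basis vector, and
   jacobian X p *m (jacobian X p)^T is the first fundamental form. *)
Definition shape_matrix (X xi : 'rV[R]_2 -> 'rV[R]_4) (p : 'rV[R]_2)
    : 'M[R]_2 :=
  - (jacobian xi p *m (jacobian X p)^T)
    *m invmx (jacobian X p *m (jacobian X p)^T).

(* xi1, xi2 is meant to be an orthonormal frame of the normal bundle of X. *)
Definition mean_curvature (X xi1 xi2 : 'rV[R]_2 -> 'rV[R]_4) (p : 'rV[R]_2)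
    : 'rV[R]_4 :=
  2^-1 *: (\tr (shape_matrix X xi1 p) *: xi1 p
           + \tr (shape_matrix X xi2 p) *: xi2 p).

End Surface.

(* Om is the surface and N the unit normal, along Om, of the hypersurfaces
   containing the u-parameter curves. *)
Section ED2Frame.
Variables (R : realType) (Om N : 'rV[R]_2 -> 'rV[R]_4).

Definition frameT : 'rV[R]_2 -> 'rV[R]_4 := pd_u Om.

Definition preE (p : 'rV[R]_2) : 'rV[R]_4 :=
  let Om_uuu := pd_u (pd_u (pd_u Om)) p in
  Om_uuu - dot Om_uuu (N p) *: N p - dot Om_uuu (frameT p) *: frameT p.

Definition frameE (p : 'rV[R]_2) : 'rV[R]_4 := normalize (preE p).

Definition frameD (p : 'rV[R]_2) : 'rV[R]_4 :=
  cross (N p) (frameT p) (frameE p).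

Definition kappa (p : 'rV[R]_2) : R := dot (pd_u frameT p) (N p).

Definition sigma (p : 'rV[R]_2) : R := dot (pd_u frameE p) (frameD p).

Definition tau (p : 'rV[R]_2) : R := dot (pd_u frameE p) (N p).

Definition a23 (p : 'rV[R]_2) : R :=
  let k := kappa p in
  let k1 := pd_u kappa p in
  let k2 := pd_u (pd_u kappa) p in
  let k3 := pd_u (pd_u (pd_u kappa)) p in
  let t := tau p in
  let t1 := pd_u tau p in
  let t2 := pd_u (pd_u tau) p in
  let t3 := pd_u (pd_u (pd_u tau)) p in
  let s := sigma p in
  let s1 := pd_u sigma p in
  - 1 / (t * k ^+ 2) *
  (- 3 * k ^+ 3 * t * s * s1 + k ^+ 5 * t1 + 2 * k ^+ 4 * t * k1
   - 2 * t * k1 ^+ 3 - k ^+ 2 * s ^+ 2 * (3 * k * t1 + 5 * t * k1)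
   + 2 * k * k1 * (k1 * t1 + 2 * t * k2) + k ^+ 3 * t3
   + k ^+ 2 * (5 * k1 * t2 + 6 * t1 * k2 + 2 * t * k3)).

Definition a34 (p : 'rV[R]_2) : R :=
  let k := kappa p in
  let k1 := pd_u kappa p in
  let k2 := pd_u (pd_u kappa) p in
  let t := tau p in
  let t1 := pd_u tau p in
  let t2 := pd_u (pd_u tau) p in
  let s := sigma p in
  1 / k * ((k * t * s ^+ 2 - 4 * k1 * t1 - k * t2) * k
           - 2 * (k1 ^+ 2 + k * k2) * t).

End ED2Frame.

(* Main.v *)
(* Write f = kappa^2 tau.  The frame equations turn the flow into Om_v = f D, so
   {T, D} spans the tangent plane and the two traces are
   tr A_E = - <E_v, D> / f and tr A_N = kappa + <D_v, N> / f.
   Hence S is minimal iff <E_v, D> = 0 and <D_v, N> = - kappa^3 tau, and it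
   remains to identify a23 = <E_v, D> and a34 = <D_v, N>.  Both come from the
   symmetry of mixed partial derivatives: T_uv = T_vu = (f D)_uu gives
   kappa <N_v, D> = f_uu - f sigma^2 and
   kappa <N_v, E> = - (2 f_u sigma + f sigma_u), and then N_uv = N_vu gives
   tau <E_v, D> = - kappa f_u - sigma <N_v, E> - <N_v, D>_u. *)
Require Import Defs.
From HB Require Import structures.
From mathcomp Require Import all_boot all_order all_algebra.
From mathcomp Require Import all_classical all_reals all_analysis.
From mathcomp Require Import ring lra.

Set Implicit Arguments.
Unset Strict Implicit.

Import Order.TTheory GRing.Theory Num.Theory.
Import numFieldNormedType.Exports.

Local Open Scope classical_set_scope.
Local Open Scope ring_scope.

(** The frame equations are not hypotheses. They are derived: those for E and D mostly from
    orthonormality, T_u from the linear dependence of N, T and [Om_uu], and the missing D component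
    of N_u from the way E is built out of [Om_uuu], where kappa must not vanish. Orders of
    differentiability are counted because a23 contains tau_uuu. From [Om] of class C^7 one gets
    [Om_uuu], hence E and D, of class C^4, and then sigma and tau of class C^3. Formulas hold only
    on the open set [U], so every differentiation of an identity goes through equality on a
    neighbourhood. The proof works with N_v instead of D_v: since N and D are orthogonal, <N_v, D> =
    - <D_v, N>, and a34 therefore appears with a minus sign. The relation for kappa <N_v, D> is
    differentiated as a product, and division by kappa and tau happens only in the final algebra. *)

(** * Closure properties of C^k functions on an open set *)

Section ClassC.
Variables (R : realType) (V : normedModType R).
Implicit Types (U : set V) (k : nat) (p w : V).

Lemma near_open U p : open U -> U p -> \forall x \near p, U x.
Proof. by move=> oU Up; apply: open_nbhs_nbhs. Qed.

Lemma derive_eq_on (W : normedModType R) U (f g : V -> W) p w :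
  open U -> (forall x, U x -> f x = g x) -> U p -> 'D_w f p = 'D_w g p.
Proof.
move=> oU fg Up; apply: near_eq_derive.
by apply: filterS (near_open oU Up) => x; exact: fg.
Qed.

(** The first-order expansion of f at p is also one of g, because the remainder only concerns points
    near p; [diff_unique] then identifies its linear part as the differential of g. *)
Lemma differentiable_near (W : normedModType R) (f g : V -> W) p :
  (\forall x \near p, f x = g x) -> differentiable f p -> differentiable g p.
Proof.
move=> fg /diff_locallyP[df fE].
have gE : g \o shift p = cst (g p) + 'd f p +o_ 0 id.
  apply/eqaddoP => e e0; move: fE => /eqaddoP /(_ e e0).
  have fgp : f p = g p by exact: nbhs_singleton fg.
  have fgs : \forall h \near (0 : V), f (h + p) = g (h + p).
    by rewrite (near_shift p) /= sub0r; apply: filterS fg => x /=; rewrite subrK.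
  move=> H; near=> h.
  rewrite !fctE /= -fgp.
  have -> : g (h + p) = f (h + p) by symmetry; near: h.
  by near: h.
apply/diff_locallyP; rewrite (diff_unique df gE); split=> //.
Unshelve. all: by end_near. Qed.

(** Derivatives at a point of an open set depend only on values in that set, so the induction passes
    from f, g to their directional derivatives. This is what lets the lemmas below replace a
    derivative by a formula valid on [U] only. *)
Lemma class_C_eq_on (W : normedModType R) k U (f g : V -> W) :
  open U -> (forall x, U x -> f x = g x) -> class_C k U f -> class_C k U g.
Proof.
move=> oU; elim: k f g => [|k IH] f g fg /=.
  move=> cf p Up; have := cf p Up; rewrite /prop_for /continuous_at (fg _ Up).
  move=> h; apply: cvg_trans h; apply: near_eq_cvg.
  by apply: filterS (near_open oU Up) => x /fg.
case=> df Df; split=> [p Up|w].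
  by apply: differentiable_near (df _ Up); apply: filterS (near_open oU Up) => x /fg.
by apply: IH (Df w) => x Ux; exact: derive_eq_on fg Ux.
Qed.

Lemma class_C_differentiable (W : normedModType R) k U (f : V -> W) p :
  class_C k.+1 U f -> U p -> differentiable f p.
Proof. by case=> + _; exact. Qed.

Lemma class_C_derive (W : normedModType R) k U (f : V -> W) w :
  class_C k.+1 U f -> class_C k U ('D_w f).
Proof. by case=> _; exact. Qed.

Lemma class_CW (W : normedModType R) k m U (f : V -> W) :
  (m <= k)%N -> class_C k U f -> class_C m U f.
Proof.
elim: k m f => [|k IH] [|m] f; rewrite ?ltn0 //=.
  move=> _ [df _] p Up; apply: differentiable_continuous; exact: df.
move=> mk [df Df]; split=> // w; exact: IH.
Qed.

Lemma class_C_continuous (W : normedModType R) k U (f : V -> W) p :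
  class_C k U f -> U p -> {for p, continuous f}.
Proof. by move=> /(class_CW (leq0n k)); exact. Qed.

Lemma class_C_cst (W : normedModType R) k U (c : W) : class_C k U (fun=> c).
Proof.
elim: k c => [|k IH] c /=; first by move=> p _; exact: cst_continuous.
split=> [p _|w]; first exact: differentiable_cst.
rewrite (_ : 'D_w _ = fun=> 0) //.
by apply/funext => x; exact: derive_cst.
Qed.

Lemma class_CD (W : normedModType R) k U (f g : V -> W) : open U ->
  class_C k U f -> class_C k U g -> class_C k U (fun x => f x + g x).
Proof.
move=> oU; elim: k f g => [|k IH] f g /=.
  by move=> cf cg p Up; apply: cvgD; [exact: cf|exact: cg].
move=> [df Df] [dg Dg]; split=> [p Up|w].
  by apply: differentiableD; [exact: df|exact: dg].
apply: class_C_eq_on oU _ (IH _ _ (Df w) (Dg w)) => x Ux /=.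
by rewrite -deriveD //; apply: diff_derivable; [exact: df|exact: dg].
Qed.

Lemma class_CM k U (f g : V -> R) : open U ->
  class_C k U f -> class_C k U g -> class_C k U (fun x => f x * g x).
Proof.
move=> oU; elim: k f g => [|k IH] f g.
  by move=> cf cg p Up; apply: cvgM; [exact: cf|exact: cg].
move=> cf cg; have [df Df] := cf; have [dg Dg] := cg; split=> [p Up|w].
  by apply: differentiableM; [exact: df|exact: dg].
apply: class_C_eq_on oU _ (class_CD oU (IH _ _ (class_CW (leqnSn k) cf) (Dg w))
  (IH _ _ (class_CW (leqnSn k) cg) (Df w))) => x Ux /=.
by rewrite -[LHS]deriveM //; apply: diff_derivable; [exact: df|exact: dg].
Qed.

Lemma class_CN k U (f : V -> R) : open U ->
  class_C k U f -> class_C k U (fun x => - f x).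
Proof.
move=> oU cf; have := class_CM oU (class_C_cst k U (-1 : R)) cf.
by apply: class_C_eq_on oU _ => x _; rewrite mulN1r.
Qed.

(** The derivative is - f^-1 f^-1 Df, a product of the inverse itself, covered by induction one
    order lower, and of Df. *)
Lemma class_CV k U (f : V -> R) : open U -> (forall x, U x -> f x != 0) ->
  class_C k U f -> class_C k U (fun x => (f x)^-1).
Proof.
move=> oU f0; elim: k f f0 => [|k IH] f f0 cf.
  by move=> p Up; apply: cvgV; [exact: f0|exact: cf].
have [df Df] := cf; split=> [p Up|w].
  by apply: differentiableV; [exact: df|exact: f0].
have iC := IH _ f0 (class_CW (leqnSn k) cf).
apply: class_C_eq_on oU _ (class_CN oU (class_CM oU (class_CM oU iC iC) (Df w))).
move=> x Ux /=.
rewrite deriveV; [|exact: f0|apply: diff_derivable; exact: df].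
by rewrite -expr2 exprVn -mulNr.
Qed.

Lemma differentiable_sqrt (x : R) : 0 < x -> differentiable (Num.sqrt : R -> R) x.
Proof.
by move=> x0; apply/derivable1_diffP; have [] := is_derive1_sqrt x0.
Qed.

Lemma class_C_sqrt k U (f : V -> R) : open U -> (forall x, U x -> 0 < f x) ->
  class_C k U f -> class_C k U (fun x => Num.sqrt (f x)).
Proof.
move=> oU f0; elim: k f f0 => [|k IH] f f0 cf.
  move=> p Up; apply: (@continuous_comp _ _ _ f Num.sqrt); first exact: cf.
  exact: sqrt_continuous.
have [df Df] := cf; split=> [p Up|w].
  by apply: (@differentiable_comp _ _ _ _ f); [exact: df|apply/differentiable_sqrt/f0].
have sC := IH _ f0 (class_CW (leqnSn k) cf).
have s0 x : U x -> 2 * Num.sqrt (f x) != 0.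
  by move=> Ux; rewrite mulf_neq0 ?pnatr_eq0 // gt_eqF ?sqrtr_gt0 ?f0.
have := class_CM oU (Df w) (class_CV oU s0 (class_CM oU (class_C_cst k U (2 : R)) sC)).
apply: class_C_eq_on oU _ => x Ux /=.
have dfx := df x Ux; have ds := differentiable_sqrt (f0 x Ux).
rewrite [RHS]deriveE; last exact: (@differentiable_comp _ _ _ _ f).
rewrite (@diff_comp _ _ _ _ f Num.sqrt) //= deriveE //.
(* The differential of the square root is linear on R, so its value at the number Df is Df times its
   value at 1, the ordinary derivative. *)
rewrite -[X in _ = 'd _ _ X]mulr1 linearZ /=; congr *%R.
by rewrite -(deriveE _ ds) derive_sqrt // f0.
Qed.

End ClassC.

(** * Reduction of row-vector-valued maps to their coordinates *)

Section RowValued.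
Variables (R : realType) (V : normedModType R) (n : nat).
Implicit Types (U : set V) (k : nat) (p w : V) (F : V -> 'rV[R]_n).

Lemma row_funE F :
  F = \sum_(j < n) (fun x => F x 0 j *: (delta_mx 0 j : 'rV[R]_n)).
Proof.
apply/funext => x; rewrite fct_sumE [LHS]row_sum_delta.
by apply: eq_bigr => j _.
Qed.

Lemma differentiable_rowP F p :
  differentiable F p <-> forall j, differentiable (fun x => F x 0 j) p.
Proof.
split=> [dF j|dF].
  exact: (@differentiable_comp _ _ _ _ F (fun M : 'rV[R]_n => M 0 j) p dF
    (differentiable_coord _ _ _)).
rewrite (row_funE F).
apply: differentiable_sum => j; exact: differentiableZl.
Qed.

Lemma derive_row F p w j :
  differentiable F p -> 'D_w F p 0 j = 'D_w (fun x => F x 0 j) p.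
Proof. by move=> dF; rewrite derive_mx ?mxE //; exact: diff_derivable. Qed.

Lemma class_C_rowP k U F : open U ->
  class_C k U F <-> forall j, class_C k U (fun x => F x 0 j).
Proof.
move=> oU; elim: k F => [|k IH] F /=.
  split=> [cF j p Up|cF p Up].
    apply: (@continuous_comp _ _ _ F (fun M : 'rV[R]_n => M 0 j)); first exact: cF.
    exact: coord_continuous.
  rewrite (row_funE F).
  apply: (big_ind (fun f : V -> 'rV[R]_n => {for p, continuous f})).
  - exact: cst_continuous.
  - by move=> f g cf cg; apply: continuousD.
  - by move=> j _; apply: cvgZl; exact: cF.
split=> [[dF DF] j|cF].
  split=> [p Up|w]; first by move: j; apply/differentiable_rowP/dF.
  have /(IH _) := DF w => /(_ j).
  by apply: class_C_eq_on oU _ => x Ux; rewrite derive_row //; exact: dF.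
have dF p : U p -> differentiable F p.
  by move=> Up; apply/differentiable_rowP => j; have [] := cF j => /(_ _ Up).
split=> // w; apply/IH => j; have [_ /(_ w)] := cF j.
by apply: class_C_eq_on oU _ => x Ux; rewrite derive_row //; exact: dF.
Qed.

Lemma class_CZ k U (a : V -> R) F : open U ->
  class_C k U a -> class_C k U F -> class_C k U (fun x => a x *: F x).
Proof.
move=> oU ca /(class_C_rowP _ _ oU) cF; apply/(class_C_rowP _ _ oU) => j.
have := class_CM oU ca (cF j).
by apply: class_C_eq_on oU _ => x _; rewrite mxE.
Qed.

Lemma is_deriveZ_fun (a : V -> R) F p w (da : R) (dF : 'rV[R]_n) :
  is_derive p w a da -> is_derive p w F dF ->
  is_derive p w (fun x => a x *: F x) (da *: F p + a p *: dF).
Proof.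
move=> [da1 da2] [dF1 dF2].
have dj j : is_derive p w (fun x => F x 0 j) (dF 0 j).
  split; first by move/derivable_mxP: dF1.
  by rewrite -dF2 derive_mx ?mxE.
have da_ : is_derive p w a da by split.
have dZ : derivable (fun x => a x *: F x) p w.
  apply/derivable_mxP => i j; rewrite ord1.
  under eq_fun do rewrite mxE.
  by have [] := is_deriveM da_ (dj j).
split=> //; rewrite derive_mx //; apply/rowP => j; rewrite !mxE.
under eq_fun do rewrite mxE.
have [_ ->] := is_deriveM da_ (dj j); rewrite addrC; congr (_ + _); exact: mulrC.
Qed.

End RowValued.

(** * Symmetry of second directional derivatives *)

Section Schwarz.
Variables (R : realType) (V : normedModType R).
Implicit Types (U : set V) (p a b w : V) (f : V -> R).

Lemma derive_translate (W : normedModType R) (f : V -> W) p c w :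
  'D_w (fun x => f (x + c)) p = 'D_w f (p + c).
Proof. by rewrite /derive /=; under eq_fun do rewrite -addrA. Qed.

Lemma differentiable_translate f p c :
  differentiable f (p + c) -> differentiable (fun x => f (x + c)) p.
Proof. by move=> df; apply: (@differentiable_comp _ _ _ _ (fun x => x + c)). Qed.

Lemma MVT_line f p w (r : R) : 0 < r ->
  (forall s, 0 <= s <= r -> differentiable f (p + s *: w)) ->
  exists2 s, 0 <= s <= r & f (p + r *: w) - f p = r * 'D_w f (p + s *: w).
Proof.
move=> r0 df; pose phi (s : R) := f (p + s *: w).
have dphi s : 0 <= s <= r -> is_derive s 1 phi ('D_w f (p + s *: w)).
  move=> sr; have dfs := df _ sr.
  have dl : is_diff s (fun s : R => p + s *: w) ( *:%R^~ w).
    apply: is_diff_eq; by rewrite /= add0r.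
  have [dl1 dl2] := dl.
  have dc : differentiable phi s.
    exact: (@differentiable_comp _ _ _ _ (fun s : R => p + s *: w)).
  split; first exact: diff_derivable.
  rewrite deriveE // (@diff_comp _ _ _ _ (fun s : R => p + s *: w) f) //=.
  by rewrite dl2 scale1r deriveE.
have [||c cr] := @MVT R phi (fun s => 'D_w f (p + s *: w)) 0 r r0.
- by move=> x; rewrite in_itv /= => /andP[x0 xr]; apply: dphi; rewrite !ltW.
- apply: derivable_within_continuous => x; rewrite in_itv /= => xr.
  by have [] := dphi x xr.
move: cr; rewrite in_itv /= => /andP[c0 cr] E; exists c; first by rewrite !ltW.
by move: E; rewrite /phi scale0r addr0 subr0 mulrC.
Qed.

(** The second difference is the increment along a of g(x) = f(x + r b) - f(x). The mean value
    theorem for g gives s; the derivative of g there is an increment of ['D_a f] along b, and a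
    second use of the theorem gives t. *)
Lemma MVT_parallelogram U f p a b (r : R) : class_C 2 U f -> 0 < r ->
  (forall s t, 0 <= s <= r -> 0 <= t <= r -> U (p + s *: a + t *: b)) ->
  exists s t, [/\ 0 <= s <= r, 0 <= t <= r &
    f (p + r *: a + r *: b) - f (p + r *: a) - (f (p + r *: b) - f p)
    = r * (r * 'D_b ('D_a f) (p + s *: a + t *: b))].
Proof.
move=> cf r0 inU.
have r01 : 0 <= r <= r by rewrite lexx ltW.
have z01 : 0 <= (0 : R) <= r by rewrite lexx ltW.
have df x : U x -> differentiable f x := class_C_differentiable cf.
have inUa s : 0 <= s <= r -> U (p + s *: a).
  by move=> sr; have := inU s 0 sr z01; rewrite scale0r addr0.
pose g x := f (x + r *: b) - f x.
have dT s : 0 <= s <= r ->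
    differentiable (fun x => f (x + r *: b)) (p + s *: a).
  by move=> sr; apply/differentiable_translate/df/inU.
have [|s sr E] := @MVT_line g p a r r0.
  move=> s sr; apply: differentiableB; first exact: dT.
  exact/df/inUa.
have [|t tr E'] := @MVT_line ('D_a f) (p + s *: a) b r r0.
  move=> t tr; apply: (class_C_differentiable (class_C_derive a cf)).
  exact: inU.
exists s, t; split=> //; rewrite -E'.
have -> : 'D_a f (p + s *: a + r *: b) - 'D_a f (p + s *: a) = 'D_a g (p + s *: a).
  rewrite [RHS]deriveB; last 2 first.
  - exact/diff_derivable/dT.
  - exact/diff_derivable/df/inUa.
  by rewrite derive_translate.
by rewrite -E /g.
Qed.

(* The second difference of f over a small parallelogram, divided by r ^+ 2, is a
   value of either mixed derivative at a point near p. *)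
Lemma derive_comm U f p a b : open U -> class_C 2 U f -> U p ->
  'D_a ('D_b f) p = 'D_b ('D_a f) p.
Proof.
move=> oU cf Up; apply/eqP; rewrite -subr_eq0 -normr_le0.
apply/ler_addgt0Pr => e e0; rewrite add0r.
have e2 : 0 < e / 2 by rewrite divr_gt0.
have ca : {for p, continuous ('D_a ('D_b f))} :=
  class_C_continuous (class_C_derive a (class_C_derive b cf)) Up.
have cb : {for p, continuous ('D_b ('D_a f))} :=
  class_C_continuous (class_C_derive b (class_C_derive a cf)) Up.
have nA := (cvgrPdist_lt _ _).1 ca _ e2.
have nB := (cvgrPdist_lt _ _).1 cb _ e2.
have [d /= d0 dB] := (nbhs_ballP _ _).1
  (filterI (near_open oU Up) (filterI (nA _) (nB _))).
(* With this r the whole parallelogram lies within d / 2 of p; the added 1 keeps the denominator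
   positive even if a and b vanish. *)
pose r := d / 2 / (`|a| + `|b| + 1).
have ab0 : 0 < `|a| + `|b| + 1 by rewrite ltr_wpDl ?addr_ge0.
have r0 : 0 < r by rewrite !divr_gt0.
have inB s t : 0 <= s <= r -> 0 <= t <= r -> ball p d (p + s *: a + t *: b).
  move=> /andP[s0 sr] /andP[t0 tr].
  rewrite -ball_normE /= -addrA opprD addNKr normrN.
  rewrite (le_lt_trans (ler_normD _ _)) // !normrZ !ger0_norm //.
  apply: (@le_lt_trans _ _ (r * (`|a| + `|b| + 1))).
    rewrite !mulrDr mulr1 -[X in X <= _]addr0 !lerD ?ler_wpM2r //.
    exact: ltW.
  by rewrite divfK ?gt_eqF // gtr_pMr // invf_lt1 ?ltr1n.
have [|s [t [sr tr E]]] := @MVT_parallelogram U f p a b r cf r0.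
  by move=> s t sr tr; case: (dB _ (inB _ _ sr tr)).
have [|t' [s' [tr' sr' E']]] := @MVT_parallelogram U f p b a r cf r0.
  by move=> t' s' tr' sr'; rewrite addrAC; case: (dB _ (inB _ _ sr' tr')).
have [_ [_ H1]] := dB _ (inB _ _ sr tr).
have [_ [H2 _]] := dB _ (inB _ _ sr' tr').
move: E E' H1 H2.
rewrite -[p + s' *: a + _]addrAC -[p + r *: b + r *: a]addrAC.
move: ('D_b ('D_a f) _) ('D_b ('D_a f) _) ('D_a ('D_b f) _) ('D_a ('D_b f) _).
move: (f _) (f _) (f _) (f _) => x1 x2 x3 x4 X A B Y E E' H1 H2.
(* The second difference is symmetric in a and b, so both mean values multiplied by r twice agree.
   Each lies within e / 2 of its derivative at p, and the triangle inequality concludes. *)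
have AY : A = Y.
  have rn0 : r != 0 by rewrite gt_eqF.
  by apply: (mulfI rn0); apply: (mulfI rn0); rewrite -E -E'; ring.
rewrite -AY in H2; rewrite -[B - X](subrKA A) (splitr e).
by rewrite (le_trans (ler_normD _ _)) // [`|A - X|]distrC lerD // ltW.
Qed.

Lemma derive_comm_row n U (F : V -> 'rV[R]_n) p a b :
  open U -> class_C 2 U F -> U p -> 'D_a ('D_b F) p = 'D_b ('D_a F) p.
Proof.
move=> oU cF Up; apply/rowP => j.
have dF x : U x -> differentiable F x := class_C_differentiable cF.
have dDF w : differentiable ('D_w F) p.
  exact: (class_C_differentiable (class_C_derive w cF)).
have E w w' : 'D_w ('D_w' F) p 0 j = 'D_w ('D_w' (fun x => F x 0 j)) p.
  rewrite derive_row //; apply: derive_eq_on oU _ Up => x Ux.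
  by rewrite derive_row //; exact: dF.
have cj := (class_C_rowP 2 F oU).1 cF j.
have C := derive_comm a b oU cj Up.
apply: (etrans (E a b)).
apply: (etrans C).
exact: (esym (E b a)).
Qed.

End Schwarz.

(** * Algebra of the inner product and the ternary product in coordinates *)

Section DotCross.
Variable R : realType.
Implicit Types (x y z w : 'rV[R]_4) (a b c : R).

(* Indexing by nat lets the ordinals produced by cofactor expansion compute. *)
Definition coord x (i : nat) : R := x 0 (inord i).

Lemma coordE x (j : 'I_4) : x 0 j = coord x j.
Proof. by rewrite /coord inord_val. Qed.

Lemma dot_sum x y : dot x y = \sum_(j < 4) x 0 j * y 0 j.
Proof. by rewrite /dot mxE; apply: eq_bigr => j _; rewrite mxE. Qed.

Lemma dotE x y : dot x y = coord x 0 * coord y 0 + coord x 1 * coord y 1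
  + coord x 2 * coord y 2 + coord x 3 * coord y 3.
Proof. by rewrite dot_sum !big_ord_recr big_ord0 /= add0r !coordE. Qed.

Definition det3 (a1 a2 a3 b1 b2 b3 c1 c2 c3 : R) : R :=
  a1 * (b2 * c3 - b3 * c2) - a2 * (b1 * c3 - b3 * c1) + a3 * (b1 * c2 - b2 * c1).

Definition minor x y z i j k : R :=
  det3 (coord x i) (coord x j) (coord x k) (coord y i) (coord y j) (coord y k)
       (coord z i) (coord z j) (coord z k).

Lemma crossE x y z : cross x y z = \row_j
  [:: minor x y z 1 2 3; - minor x y z 0 2 3;
      minor x y z 0 1 3; - minor x y z 0 1 2]`_j.
Proof.
have det2 (A : 'M[R]_2) : \det A = A 0 0 * A 1 1 - A 0 1 * A 1 0.
  rewrite (expand_det_row _ 0) !big_ord_recl big_ord0 /cofactor /= !det_mx11 !mxE.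
  rewrite /= addr0 expr0 mul1r expr1 mulN1r mulrN.
  by congr (A _ _ * A _ _ - A _ _ * A _ _); apply/val_inj.
(* The first row is the j-th basis vector, so expansion along it leaves a single cofactor, up to
   sign a 3 by 3 minor of x, y, z. *)
apply/rowP => j; rewrite !mxE (expand_det_row _ 0) (bigD1 j) //=.
rewrite big1 ?addr0; last first.
  by move=> i ij; rewrite !mxE /= (negbTE ij) mul0r.
rewrite [X in X * _]mxE /= mxE !eqxx mul1r /cofactor.
case: j => [[|[|[|[|]]]] //= ?];
  rewrite (expand_det_row _ 0) !big_ord_recl big_ord0 /cofactor /= !det2 !mxE /=;
  rewrite !coordE /= /bump /= /minor /det3; ring.
Qed.

Lemma coord_cross x y z i : (i < 4)%N -> coord (cross x y z) i =
  [:: minor x y z 1 2 3; - minor x y z 0 2 3;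
      minor x y z 0 1 3; - minor x y z 0 1 2]`_i.
Proof. by move=> i4; rewrite crossE /coord mxE inordK. Qed.

(** This is the Gram determinant identity; for an orthonormal triple it shows that [frameD] has unit
    length. *)
Lemma dot_cross_cross x y z : dot (cross x y z) (cross x y z) =
  det3 (dot x x) (dot x y) (dot x z) (dot y x) (dot y y) (dot y z)
       (dot z x) (dot z y) (dot z z).
Proof. rewrite /det3 !dotE !coord_cross //= /minor /det3; ring. Qed.

Lemma dot_cross1 x y z : dot x (cross x y z) = 0.
Proof. rewrite dotE !coord_cross //= /minor /det3; ring. Qed.

Lemma dot_cross2 x y z : dot y (cross x y z) = 0.
Proof. rewrite dotE !coord_cross //= /minor /det3; ring. Qed.

Lemma dot_cross3 x y z : dot z (cross x y z) = 0.
Proof. rewrite dotE !coord_cross //= /minor /det3; ring. Qed.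

Lemma coordD x y i : coord (x + y) i = coord x i + coord y i.
Proof. by rewrite /coord mxE. Qed.

Lemma coordN x i : coord (- x) i = - coord x i.
Proof. by rewrite /coord mxE. Qed.

Lemma coordZ a x i : coord (a *: x) i = a * coord x i.
Proof. by rewrite /coord mxE. Qed.

Lemma coord_ext x y : (forall i, (i < 4)%N -> coord x i = coord y i) -> x = y.
Proof. by move=> xy; apply/rowP => j; rewrite !coordE xy. Qed.

(** Alternation kills the x and y parts of the last factor, and the sign comes from exchanging the
    first two. With N, T, E for x, y, z it converts the right side of the flow into a multiple of D
    = N x T x E. *)
Lemma cross_lin x y z a b c d :
  cross y (a *: x) (b *: x + c *: y + d *: z) = (- (a * d)) *: cross x y z.
Proof.
apply: coord_ext => i i4; rewrite coordZ !coord_cross //.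
by case: i i4 => [|[|[|[|]]]] //= _; rewrite /minor /det3 !coordD !coordZ; ring.
Qed.

Lemma dotC x y : dot x y = dot y x.
Proof. rewrite !dotE; ring. Qed.

Lemma dotDl x y z : dot (x + y) z = dot x z + dot y z.
Proof. rewrite !dotE !coordD; ring. Qed.

Lemma dotNl x y : dot (- x) y = - dot x y.
Proof. rewrite !dotE !coordN; ring. Qed.

Lemma dotZl a x y : dot (a *: x) y = a * dot x y.
Proof. rewrite !dotE !coordZ; ring. Qed.

Lemma dot_comb a b x y z : dot (a *: x + b *: y) z = a * dot x z + b * dot y z.
Proof. by rewrite dotDl !dotZl. Qed.

Lemma dot0l x : dot 0 x = 0.
Proof. by rewrite -(scale0r 0) dotZl mul0r. Qed.

Lemma dotDr x y z : dot z (x + y) = dot z x + dot z y.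
Proof. by rewrite dotC dotDl !(dotC z). Qed.

Lemma dotZr a x y : dot y (a *: x) = a * dot y x.
Proof. by rewrite dotC dotZl dotC. Qed.

Lemma dot_combr a b x y z : dot z (a *: x + b *: y) = a * dot z x + b * dot z y.
Proof. by rewrite dotDr !dotZr. Qed.

Lemma dot_ge0 x : 0 <= dot x x.
Proof. by rewrite dotE -!expr2 !addr_ge0 ?sqr_ge0. Qed.

Lemma dot_eq0 x : dot x x = 0 -> x = 0.
Proof.
rewrite dot_sum => /eqP; rewrite psumr_eq0 => [/allP x0|j _]; last first.
  by rewrite -expr2 sqr_ge0.
apply/rowP => j; rewrite mxE; apply/eqP; have := x0 j (mem_index_enum _).
by rewrite /= mulf_eq0 orbb.
Qed.

Lemma enorm_gt0 x : x != 0 -> 0 < enorm x.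
Proof.
move=> x0; rewrite /enorm sqrtr_gt0 lt_def dot_ge0 andbT.
by apply: contra x0 => /eqP /dot_eq0 ->.
Qed.

Lemma enorm_sqr x : enorm x ^+ 2 = dot x x.
Proof. by rewrite /enorm sqr_sqrtr ?dot_ge0. Qed.

Lemma dot_normalize x : x != 0 -> dot (normalize x) (normalize x) = 1.
Proof.
move=> x0; rewrite /normalize dotZl dotZr mulrA -enorm_sqr expr2.
by rewrite mulrACA mulVf ?mulr1 // gt_eqF ?enorm_gt0.
Qed.

Definition orthonormal4 x y z w := [/\ [/\ dot x x = 1, dot y y = 1, dot z z = 1
  & dot w w = 1], [/\ dot x y = 0, dot x z = 0 & dot x w = 0],
  dot y z = 0, dot y w = 0 & dot z w = 0].

(** The matrix [M] with these rows satisfies [M *m M^T = 1], so right multiplication by [M^T] is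
    injective, and it lists the four inner products of a vector with the frame. The formulas for
    E_u, N_u and D_u are proved by this comparison. *)
Lemma orthonormal4_ext x y z w u v : orthonormal4 x y z w ->
  dot u x = dot v x -> dot u y = dot v y -> dot u z = dot v z ->
  dot u w = dot v w -> u = v.
Proof.
move=> [[xx yy zz ww] [xy xz xw] yz yw zw] ux uy uz uw.
pose M : 'M[R]_4 := \matrix_(i < 4) [:: x; y; z; w]`_i.
have MM : M *m M^T = 1%:M.
  apply/matrixP => i j; rewrite mxE.
  under eq_bigr do rewrite !mxE.
  rewrite -dot_sum mxE.
  by case: i j => [[|[|[|[|]]]] //= ?] [[|[|[|[|]]]] //= ?]; rewrite // dotC.
have [Mu _] := mulmx1_unit MM.
have Mtu : M^T \in unitmx by rewrite unitmx_tr.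
apply: (can_inj (mulmxK Mtu)).
apply/rowP => i; rewrite !mxE.
under eq_bigr do rewrite !mxE.
under [RHS]eq_bigr do rewrite !mxE.
rewrite -!dot_sum.
by case: i => [[|[|[|[|]]]] //= ?].
Qed.

End DotCross.

(** * Calculus of inner and ternary products of vector fields *)

Section VectorCalculus.
Variables (R : realType) (V : normedModType R).
Implicit Types (U : set V) (k : nat) (p w : V) (F G H : V -> 'rV[R]_4).

Lemma class_C_is_derive (W : normedModType R) k U (f : V -> W) p w :
  class_C k.+1 U f -> U p -> is_derive p w f ('D_w f p).
Proof.
by move=> cf Up; apply/derivableP/diff_derivable/(class_C_differentiable cf).
Qed.

Lemma class_C_coordP k U F : open U ->
  class_C k U F <-> forall i, (i < 4)%N -> class_C k U (fun x => coord (F x) i).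
Proof.
move=> oU; split=> [/(class_C_rowP _ _ oU) cF i _|cF]; first exact: cF.
apply/(class_C_rowP _ _ oU) => j; have := cF j (ltn_ord j).
by apply: class_C_eq_on oU _ => x _; rewrite coordE.
Qed.

Lemma class_C_dot k U F G : open U -> class_C k U F -> class_C k U G ->
  class_C k U (fun x => dot (F x) (G x)).
Proof.
move=> oU /(class_C_coordP _ _ oU) cF /(class_C_coordP _ _ oU) cG.
apply: (class_C_eq_on oU (fun x _ => esym (dotE (F x) (G x)))).
by do ![apply: class_CD => //]; apply: class_CM; auto.
Qed.

Lemma class_C_minor k U F G H i j l : open U ->
  (i < 4)%N -> (j < 4)%N -> (l < 4)%N ->
  class_C k U F -> class_C k U G -> class_C k U H ->
  class_C k U (fun x => minor (F x) (G x) (H x) i j l).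
Proof.
move=> oU i4 j4 l4 /(class_C_coordP _ _ oU) cF /(class_C_coordP _ _ oU) cG
  /(class_C_coordP _ _ oU) cH; rewrite /minor /det3.
apply: class_CD => //; first apply: class_CD => //; last first.
- by apply: class_CM; auto; apply: class_CD => //; [|apply: class_CN => //];
    apply: class_CM; auto.
- by apply: class_CN => //; apply: class_CM; auto; apply: class_CD => //;
    [|apply: class_CN => //]; apply: class_CM; auto.
- by apply: class_CM; auto; apply: class_CD => //; [|apply: class_CN => //];
    apply: class_CM; auto.
Qed.

Lemma class_C_cross k U F G H : open U ->
  class_C k U F -> class_C k U G -> class_C k U H ->
  class_C k U (fun x => cross (F x) (G x) (H x)).
Proof.
move=> oU cF cG cH; apply/(class_C_coordP _ _ oU) => i i4.
apply: (class_C_eq_on oU (fun x _ => esym (coord_cross (F x) (G x) (H x) i4))).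
by case: i i4 => [|[|[|[|]]]] //= _; do ?[apply: class_CN => //];
  exact: class_C_minor.
Qed.

Lemma class_C_normalize k U F : open U -> (forall x, U x -> F x != 0) ->
  class_C k U F -> class_C k U (fun x => normalize (F x)).
Proof.
move=> oU F0 cF; apply: class_CZ => //.
apply: class_CV => // [x Ux|]; first by rewrite gt_eqF ?enorm_gt0 ?F0.
apply: class_C_sqrt => // [x Ux|]; last exact: class_C_dot.
by rewrite -sqrtr_gt0 enorm_gt0 ?F0.
Qed.

Lemma is_derive_coord F p w (dF : 'rV[R]_4) i :
  is_derive p w F dF -> is_derive p w (fun x => coord (F x) i) (coord dF i).
Proof.
move=> [dF1 <-]; split; first by move/derivable_mxP: dF1; exact.
by rewrite derive_mx // /coord mxE.
Qed.

Lemma is_derive_dot F G p w (dF dG : 'rV[R]_4) :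
  is_derive p w F dF -> is_derive p w G dG ->
  is_derive p w (fun x => dot (F x) (G x)) (dot dF (G p) + dot (F p) dG).
Proof.
move=> hF hG.
have hFi i := is_derive_coord i hF; have hGi i := is_derive_coord i hG.
have hM i := is_deriveM (hFi i) (hGi i).
have := is_deriveD (is_deriveD (is_deriveD (hM 0) (hM 1)) (hM 2)) (hM 3).
rewrite (_ : _ + _ + _ + _ = fun x => dot (F x) (G x)); last first.
  by apply/funext => x; rewrite dotE.
by move=> h; apply: is_derive_eq h _; rewrite !dotE /GRing.scale /=; ring.
Qed.

Lemma derive_dot_cst U F G p w c : open U ->
  (forall x, U x -> dot (F x) (G x) = c) -> U p ->
  class_C 1 U F -> class_C 1 U G ->
  dot ('D_w F p) (G p) = - dot (F p) ('D_w G p).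
Proof.
move=> oU FG Up cF cG.
have [_ E] := is_derive_dot (class_C_is_derive w cF Up) (class_C_is_derive w cG Up).
apply/eqP; rewrite -addr_eq0 -E.
by rewrite (derive_eq_on _ oU FG Up) derive_cst.
Qed.

Lemma derive_dot_self U F p w c : open U ->
  (forall x, U x -> dot (F x) (F x) = c) -> U p -> class_C 1 U F ->
  dot ('D_w F p) (F p) = 0.
Proof.
move=> oU FF Up cF; have := derive_dot_cst w oU FF Up cF cF.
by rewrite (dotC (F p)) => /eqP; rewrite -addr_eq0 -mulr2n mulrn_eq0 /= => /eqP.
Qed.

End VectorCalculus.

(** * Evolution in v of an abstract frame obeying the ED frame equations *)

Section FrameEvolution.
Variables (R : realType) (U : set 'rV[R]_2).
Variables (T E D N : 'rV[R]_2 -> 'rV[R]_4) (k s t : 'rV[R]_2 -> R).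
Hypotheses (oU : open U)
  (frame : forall p, U p -> orthonormal4 (T p) (E p) (D p) (N p))
  (cT : class_C 2 U T) (cE : class_C 1 U E) (cD : class_C 1 U D)
  (cN : class_C 2 U N) (ck : class_C 3 U k) (cs : class_C 1 U s)
  (ct : class_C 3 U t)
  (Tu : forall p, U p -> pd_u T p = k p *: N p)
  (Eu : forall p, U p -> pd_u E p = s p *: D p + t p *: N p)
  (Du : forall p, U p -> pd_u D p = - s p *: E p)
  (Nu : forall p, U p -> pd_u N p = - k p *: T p + - t p *: E p)
  (Tv : forall p, U p -> pd_v T p = pd_u (fun x => (k x ^+ 2 * t x) *: D x) p).

(** This is the coefficient of D in the flow Om_v = f D. In this section the flow enters through
    [Tv], the u-derivative of that equation. *)
Let f x := k x ^+ 2 * t x.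

Local Notation e0 := (delta_mx 0 0 : 'rV[R]_2).
Local Notation e1 := (delta_mx 0 1 : 'rV[R]_2).

Lemma class_C_speed : class_C 3 U f.
Proof.
apply: class_C_eq_on oU _ (class_CM oU (class_CM oU ck ck) ct) => x _.
by rewrite /f expr2.
Qed.

Let cf := class_C_speed.
Let cfu : class_C 2 U (pd_u f) := class_C_derive e0 cf.
Let cfuu : class_C 1 U (pd_u (pd_u f)) := class_C_derive e0 cfu.

Lemma frame_Tv p : U p -> pd_v T p = pd_u f p *: D p + f p *: (- s p *: E p).
Proof.
move=> Up; rewrite Tv // -Du //.
by have [] := is_deriveZ_fun (class_C_is_derive e0 cf Up) (class_C_is_derive e0 cD Up).
Qed.

(** The right side keeps the shape given by the product rule; its D and E components are extracted
    later by taking inner products. *)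
Lemma frame_Tvu p : U p -> pd_u (pd_v T) p =
  (pd_u (pd_u f) p *: D p + pd_u f p *: (- s p *: E p)) +
  (pd_u f p *: (- s p *: E p) + f p *: (- pd_u s p *: E p
    + - s p *: (s p *: D p + t p *: N p))).
Proof.
move=> Up; rewrite -Eu // -{1}Du //.
have hs := is_deriveN (class_C_is_derive e0 cs Up).
have hD := class_C_is_derive e0 cD Up.
have hE := class_C_is_derive e0 cE Up.
have hf := class_C_is_derive e0 cf Up.
have hfu := class_C_is_derive e0 cfu Up.
have [_ <-] := is_deriveD (is_deriveZ_fun hfu hD)
  (is_deriveZ_fun hf (is_deriveZ_fun hs hE)).
exact: derive_eq_on oU frame_Tv Up.
Qed.

Lemma frame_Tuv p : U p ->
  pd_v (pd_u T) p = pd_v k p *: N p + k p *: pd_v N p.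
Proof.
move=> Up.
have hk := class_C_is_derive e1 ck Up; have hN := class_C_is_derive e1 cN Up.
have [_ <-] := is_deriveZ_fun hk hN.
exact: derive_eq_on oU Tu Up.
Qed.

Lemma frame_mixed p : U p -> pd_v k p *: N p + k p *: pd_v N p =
  (pd_u (pd_u f) p *: D p + pd_u f p *: (- s p *: E p)) +
  (pd_u f p *: (- s p *: E p) + f p *: (- pd_u s p *: E p
    + - s p *: (s p *: D p + t p *: N p))).
Proof.
move=> Up; apply: (etrans (esym (frame_Tuv Up))).
apply: (etrans _ (frame_Tvu Up)).
exact: derive_comm_row oU cT Up.
Qed.

Lemma frame_NvD p : U p ->
  k p * dot (pd_v N p) (D p) = pd_u (pd_u f) p - f p * s p ^+ 2.
Proof.
move=> Up; have [[TT EE DD NN] [TE TD TN] ED EN DN] := frame Up.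
have := congr1 (fun z => dot z (D p)) (frame_mixed Up).
by rewrite /= !(dotDl, dotZl) DD ED (dotC (N p)) DN => H; ring: H.
Qed.

Lemma frame_NvE p : U p ->
  k p * dot (pd_v N p) (E p) = - (2 * pd_u f p * s p + f p * pd_u s p).
Proof.
move=> Up; have [[TT EE DD NN] [TE TD TN] ED EN DN] := frame Up.
have := congr1 (fun z => dot z (E p)) (frame_mixed Up).
by rewrite /= !(dotDl, dotZl) EE (dotC (D p)) ED (dotC (N p)) EN => H; ring: H.
Qed.

(** Take the D component of N_vu = (- k T - t E)_v. On the right T_v contributes f_u. On the left,
    <N_vu, D> = <N_v, D>_u - <N_v, D_u>, and D_u = - s E brings in <N_v, E>. *)
Lemma frame_EvD p : U p -> t p * dot (pd_v E p) (D p) =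
  - (k p * pd_u f p) - s p * dot (pd_v N p) (E p)
  - pd_u (fun x => dot (pd_v N x) (D x)) p.
Proof.
move=> Up; have [[TT EE DD NN] [TE TD TN] ED EN DN] := frame Up.
have cNv : class_C 1 U (pd_v N) := class_C_derive e1 cN.
have hk := is_deriveN (class_C_is_derive e1 ck Up).
have ht := is_deriveN (class_C_is_derive e1 ct Up).
have hT := class_C_is_derive e1 cT Up.
have hE := class_C_is_derive e1 cE Up.
have Nvu : pd_u (pd_v N) p =
    - pd_v k p *: T p + - k p *: pd_v T p + (- pd_v t p *: E p + - t p *: pd_v E p).
  apply: (etrans (derive_comm_row e0 e1 oU cN Up)).
  have [_ <-] := is_deriveD (is_deriveZ_fun hk hT) (is_deriveZ_fun ht hE).
  exact: derive_eq_on oU Nu Up.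
have Dc : pd_u (fun x => dot (pd_v N x) (D x)) p =
    dot (pd_u (pd_v N) p) (D p) + dot (pd_v N p) (pd_u D p).
  exact: @derive_val _ _ _ _ _ _ _ (is_derive_dot
    (class_C_is_derive e0 cNv Up) (class_C_is_derive e0 cD Up)).
have Nd := congr1 (fun z => dot z (D p)) Nvu.
move: Dc Nd.
move: (pd_u (fun x => _) p) (pd_u (pd_v N) p) => X Y.
rewrite Du // frame_Tv //= !(dotDl, dotZl, dotZr) TD ED DD.
move=> -> ->; ring.
Qed.

Let k1 := pd_u k.
Let k2 := pd_u k1.
Let k3 := pd_u k2.
Let t1 := pd_u t.
Let t2 := pd_u t1.
Let t3 := pd_u t2.
Let ck1 : class_C 2 U k1 := class_C_derive e0 ck.
Let ck2 : class_C 1 U k2 := class_C_derive e0 ck1.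
Let ct1 : class_C 2 U t1 := class_C_derive e0 ct.
Let ct2 : class_C 1 U t2 := class_C_derive e0 ct1.

Lemma speed_u p : U p -> pd_u f p = 2 * k p * k1 p * t p + k p ^+ 2 * t1 p.
Proof.
move=> Up.
have hk : is_derive p e0 k (k1 p) := class_C_is_derive e0 ck Up.
have ht : is_derive p e0 t (t1 p) := class_C_is_derive e0 ct Up.
have [_ H] := is_deriveM (is_deriveM hk hk) ht.
apply: (etrans _ (etrans H _)).
  by apply: derive_eq_on oU _ Up => x _; rewrite /f expr2.
rewrite /GRing.scale /= !fctE; ring.
Qed.

Lemma speed_uu p : U p -> pd_u (pd_u f) p =
  2 * k1 p ^+ 2 * t p + 2 * k p * k2 p * t p + 4 * k p * k1 p * t1 p
  + k p ^+ 2 * t2 p.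
Proof.
move=> Up.
have hk : is_derive p e0 k (k1 p) := class_C_is_derive e0 ck Up.
have ht : is_derive p e0 t (t1 p) := class_C_is_derive e0 ct Up.
have hk1 : is_derive p e0 k1 (k2 p) := class_C_is_derive e0 ck1 Up.
have ht1 : is_derive p e0 t1 (t2 p) := class_C_is_derive e0 ct1 Up.
(* The coefficient 2 of k k1 t is obtained by adding this product to itself, so that no constant
   factor has to be differentiated. *)
have hkk1t := is_deriveM (is_deriveM hk hk1) ht.
have [_ H] := is_deriveD (is_deriveD hkk1t hkk1t) (is_deriveM (is_deriveM hk hk) ht1).
apply: (etrans _ (etrans H _)).
  by apply: derive_eq_on oU _ Up => x Ux; rewrite speed_u // !fctE; ring.
rewrite /GRing.scale /= !fctE; ring.
Qed.

Lemma speed_uuu p : U p -> pd_u (pd_u (pd_u f)) p =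
  k p ^+ 2 * t3 p + 6 * k p * k1 p * t2 p + 6 * (k1 p ^+ 2 + k p * k2 p) * t1 p
  + (6 * k1 p * k2 p + 2 * k p * k3 p) * t p.
Proof.
move=> Up.
have hk : is_derive p e0 k (k1 p) := class_C_is_derive e0 ck Up.
have ht : is_derive p e0 t (t1 p) := class_C_is_derive e0 ct Up.
have hk1 : is_derive p e0 k1 (k2 p) := class_C_is_derive e0 ck1 Up.
have ht1 : is_derive p e0 t1 (t2 p) := class_C_is_derive e0 ct1 Up.
have hk2 : is_derive p e0 k2 (k3 p) := class_C_is_derive e0 ck2 Up.
have ht2 : is_derive p e0 t2 (t3 p) := class_C_is_derive e0 ct2 Up.
have h1 := is_deriveM (is_deriveM hk1 hk1) ht.
have h2 := is_deriveM (is_deriveM hk hk2) ht.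
have h3 := is_deriveM (is_deriveM hk hk1) ht1.
have h4 := is_deriveM (is_deriveM hk hk) ht2.
have h12 := is_deriveD h1 h2.
have h33 := is_deriveD h3 h3.
have [_ H] := is_deriveD (is_deriveD (is_deriveD h12 h12) (is_deriveD h33 h33)) h4.
apply: (etrans _ (etrans H _)).
  by apply: derive_eq_on oU _ Up => x Ux; rewrite speed_uu // !fctE; ring.
rewrite /GRing.scale /= !fctE; ring.
Qed.

Hypotheses (k0 : forall p, U p -> k p != 0) (t0 : forall p, U p -> t p != 0).

(** This is the u-derivative of [frame_NvD], taken before dividing by k; it is a linear equation for
    <N_v, D>_u, the last unknown of [frame_EvD]. *)
Lemma frame_NvD_deriv p : U p ->
  k1 p * dot (pd_v N p) (D p) + k p * pd_u (fun x => dot (pd_v N x) (D x)) p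
  = pd_u (pd_u (pd_u f)) p - pd_u f p * s p ^+ 2 - 2 * f p * s p * pd_u s p.
Proof.
move=> Up.
have cNv : class_C 1 U (pd_v N) := class_C_derive e1 cN.
have hk : is_derive p e0 k (k1 p) := class_C_is_derive e0 ck Up.
have hs : is_derive p e0 s (pd_u s p) := class_C_is_derive e0 cs Up.
have hf : is_derive p e0 f (pd_u f p) := class_C_is_derive e0 cf Up.
have hfuu : is_derive p e0 (pd_u (pd_u f)) (pd_u (pd_u (pd_u f)) p) :=
  class_C_is_derive e0 cfuu Up.
have hc : is_derive p e0 (fun x => dot (pd_v N x) (D x))
    (pd_u (fun x => dot (pd_v N x) (D x)) p) :=
  class_C_is_derive e0 (class_C_dot oU cNv cD) Up.
have [_ H1] := is_deriveM hk hc.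
have [_ H2] := is_deriveB hfuu (is_deriveM hf (is_deriveM hs hs)).
have H : 'D_e0 (k * (fun x => dot (pd_v N x) (D x))) p
       = 'D_e0 (pd_u (pd_u f) - f * (s * s)) p.
  by apply: derive_eq_on oU _ Up => x Ux; rewrite !fctE frame_NvD // expr2.
move: (etrans (esym H1) (etrans H H2)).
(* Stated for plain reals so that [ring] applies; the final [exact] matches the scalings and
   function products of the product rule up to conversion. *)
have aux (K X d K1 Y F S W Z : R) :
    K * X + d * K1 = Y - (F * (S * W + S * W) + S * S * Z) ->
    K1 * d + K * X = Y - Z * S ^+ 2 - 2 * F * S * W.
  by move=> E1; rewrite addrC [K1 * d]mulrC E1; ring.
exact: aux.
Qed.

Lemma frame_a34 p : U p -> dot (pd_v N p) (D p) =
  - (1 / k p * ((k p * t p * s p ^+ 2 - 4 * k1 p * t1 p - k p * t2 p) * k p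
                - 2 * (k1 p ^+ 2 + k p * k2 p) * t p)).
Proof.
move=> Up; apply: (mulfI (k0 Up)).
by rewrite frame_NvD // speed_uu // /f; field; rewrite k0.
Qed.

(** The relations for <E_v, D>, <N_v, D>, <N_v, E> and <N_v, D>_u are each solved by one division by
    t or k; substituting them and expanding the derivatives of f leaves a rational identity. *)
Lemma frame_a23 p : U p -> dot (pd_v E p) (D p) =
  - 1 / (t p * k p ^+ 2) *
  (- 3 * k p ^+ 3 * t p * s p * pd_u s p + k p ^+ 5 * t1 p
   + 2 * k p ^+ 4 * t p * k1 p - 2 * t p * k1 p ^+ 3
   - k p ^+ 2 * s p ^+ 2 * (3 * k p * t1 p + 5 * t p * k1 p)
   + 2 * k p * k1 p * (k1 p * t1 p + 2 * t p * k2 p) + k p ^+ 3 * t3 p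
   + k p ^+ 2 * (5 * k1 p * t2 p + 6 * t1 p * k2 p + 2 * t p * k3 p)).
Proof.
move=> Up; have kp := k0 Up; have tp := t0 Up.
have divE (x y z : R) : x != 0 -> x * y = z -> y = z / x.
  by move=> x0 <-; field.
have EvD := divE _ _ _ tp (frame_EvD Up).
have NvD := divE _ _ _ kp (frame_NvD Up).
have NvE := divE _ _ _ kp (frame_NvE Up).
have := frame_NvD_deriv Up; move/(canRL (addKr _)) => /(divE _ _ _ kp) NvDu.
rewrite EvD NvDu NvE NvD speed_uuu // speed_uu // speed_u // /f.
by field; rewrite kp tp.
Qed.

End FrameEvolution.

(** * Traces of shape operators for an orthogonal parametrization *)

Section Surface.
Variable R : realType.
Implicit Types (X xi : 'rV[R]_2 -> 'rV[R]_4) (p : 'rV[R]_2).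

Local Notation e0 := (delta_mx 0 0 : 'rV[R]_2).
Local Notation e1 := (delta_mx 0 1 : 'rV[R]_2).

Lemma jacobian_gramE X xi p i j : differentiable X p -> differentiable xi p ->
  (jacobian xi p *m (jacobian X p)^T) i j
  = dot ('D_(delta_mx 0 i) xi p) ('D_(delta_mx 0 j) X p).
Proof.
move=> dX dxi; rewrite !deriveEjacobian // -!rowE.
move: (jacobian X p) (jacobian xi p) => A B.
by rewrite dot_sum mxE; apply: eq_bigr => l _; rewrite !mxE.
Qed.

Lemma tr_mul_invmx_diag (G K : 'M[R]_2) (a b : R) : a != 0 -> b != 0 ->
  G 0 0 = a -> G 1 1 = b -> G 0 1 = 0 -> G 1 0 = 0 ->
  \tr (K *m invmx G) = K 0 0 / a + K 1 1 / b.
Proof.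
move=> a0 b0 G00 G11 G01 G10.
have I2 (i : 'I_2) : i = 0 \/ i = 1.
  by case: i => [[|[|//]]] ?; [left|right]; exact/val_inj.
pose d : 'rV[R]_2 := \row_j [:: a^-1; b^-1]`_j.
have GE : G *m diag_mx d = 1%:M.
  apply/matrixP => i j; rewrite mul_mx_diag !mxE.
  by case: (I2 i) (I2 j) => -> [] ->; rewrite ?G00 ?G11 ?G01 ?G10 ?mul0r ?divff.
have -> : invmx G = diag_mx d.
  by rewrite -[RHS]mul1mx -(mulVmx (mulmx1_unit GE).1) -mulmxA GE mulmx1.
rewrite /mxtrace !big_ord_recl big_ord0 addr0 mul_mx_diag !mxE.
by congr (K _ _ / _ + K _ _ / _); exact/val_inj.
Qed.

(** The first fundamental form is diag(1, f^2), so only diagonal entries contribute to the trace;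
    one factor f cancels because X_v = f D. *)
Lemma tr_shape_matrix X xi p (f : R) (D : 'rV[R]_4) :
  differentiable X p -> differentiable xi p -> f != 0 ->
  dot (pd_u X p) (pd_u X p) = 1 -> dot (pd_u X p) D = 0 -> dot D D = 1 ->
  pd_v X p = f *: D ->
  \tr (shape_matrix X xi p) = - (dot (pd_u xi p) (pd_u X p) + dot (pd_v xi p) D / f).
Proof.
move=> dX dxi f0 uu uD DD vE; rewrite /shape_matrix.
have vv : dot (pd_v X p) (pd_v X p) = f ^+ 2.
  by rewrite vE dotZl dotZr DD mulr1 expr2.
have uv : dot (pd_u X p) (pd_v X p) = 0 by rewrite vE dotZr uD mulr0.
have vu : dot (pd_v X p) (pd_u X p) = 0 by rewrite dotC.
have Guu := etrans (jacobian_gramE 0 0 dX dX) uu.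
have Gvv := etrans (jacobian_gramE 1 1 dX dX) vv.
have Guv := etrans (jacobian_gramE 0 1 dX dX) uv.
have Gvu := etrans (jacobian_gramE 1 0 dX dX) vu.
have K0 : (jacobian xi p *m (jacobian X p)^T) 0 0 = dot (pd_u xi p) (pd_u X p).
  exact: jacobian_gramE.
have K1 : (jacobian xi p *m (jacobian X p)^T) 1 1 = dot (pd_v xi p) (pd_v X p).
  exact: jacobian_gramE.
have vE' : dot (pd_v xi p) (pd_v X p) = f * dot (pd_v xi p) D.
  exact: etrans (congr1 (dot (pd_v xi p)) vE) (dotZr _ _ _).
have oppE (M : 'M[R]_2) i j : (- M) i j = - M i j by rewrite mxE.
have simpl_tr (a b : R) : - a / 1 + - (f * b) / f ^+ 2 = - (a + b / f).
  by field.
apply: (etrans (tr_mul_invmx_diag _ (oner_neq0 R) (expf_neq0 2 f0) Guu Gvv Guv Gvu)).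
rewrite !oppE K0 (etrans K1 vE'); exact: simpl_tr.
Qed.

End Surface.

(** * The hypersurface normal along a u-curve, and linear dependence with T *)

Section Normal.
Variable R : realType.

Lemma derive_grad (f : 'rV[R]_4 -> R) (x w : 'rV[R]_4) :
  differentiable f x -> 'D_w f x = dot (grad f x) w.
Proof.
move=> df; rewrite deriveE // [in LHS](row_sum_delta w) linear_sum dot_sum.
apply: eq_bigr => i _; rewrite linearZ /= mxE deriveE //; exact: mulrC.
Qed.

Lemma derive_comp_grad (V : normedModType R) (F : V -> 'rV[R]_4)
    (f : 'rV[R]_4 -> R) (p w : V) :
  differentiable F p -> differentiable f (F p) ->
  'D_w (f \o F) p = dot (grad f (F p)) ('D_w F p).
Proof.
move=> dF df; rewrite -derive_grad // deriveE; last exact: differentiable_comp.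
by rewrite diff_comp // [RHS]deriveE // [in RHS]deriveE.
Qed.

(** Only the values on the line through p matter. This is the right form for a defining function
    composed with [Om], which is known to vanish along one u-curve and not on a neighbourhood of
    p. *)
Lemma derive_line0 (V : normedModType R) (g : V -> R) (p w : V) :
  (\forall h \near (0 : R), g (h *: w + p) = 0) -> 'D_w g p = 0.
Proof.
move=> g0; rewrite /derive; apply: cvg_lim => //.
apply: (@cvg_trans _ ((fun=> 0 : R) @ (0 : R)^')); last exact: cvg_cst.
have gp : g p = 0 by have := nbhs_singleton g0; rewrite scale0r add0r.
apply: near_eq_cvg; apply: cvg_within; apply: filterS g0 => h gh.
by rewrite /= gp subr0 gh scaler0.
Qed.

Lemma oriented_hypersurface_normal (U : set 'rV[R]_2) (Om : 'rV[R]_2 -> 'rV[R]_4)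
    (M : set 'rV[R]_4) (nu : 'rV[R]_4 -> 'rV[R]_4) (p : 'rV[R]_2) :
  open U -> U p -> differentiable Om p -> oriented_hypersurface M nu ->
  (forall q, U q -> q 0 1 = p 0 1 -> M (Om q)) ->
  dot (nu (Om p)) (nu (Om p)) = 1 /\ dot (nu (Om p)) (pd_u Om p) = 0.
Proof.
move=> oU Up dOm hM MU; have Mp := MU p Up erefl.
have [W [f [oW Wp cf Mf Gf]]] := hM _ Mp.
have [g0 ->] := Gf _ Wp Mp; split; first exact: dot_normalize.
have df := class_C_differentiable cf Wp.
rewrite /normalize dotZl -derive_comp_grad //.
(* f vanishes along the u-curve through p, which stays in M. *)
rewrite derive_line0 ?mulr0 //.
have UW : \forall q \near p, U q /\ W (Om q).
  have nW : nbhs p (Om @^-1` W).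
    by apply: (differentiable_continuous dOm); exact: open_nbhs_nbhs.
  exact: filterI (near_open oU Up) nW.
have lc : (fun h : R => h *: (delta_mx 0 0 : 'rV[R]_2) + p) @ (0 : R) --> p.
  have : (fun h : R => h *: (delta_mx 0 0 : 'rV[R]_2) + p) @ (0 : R)
      --> 0 *: (delta_mx 0 0 : 'rV[R]_2) + p.
    by apply: cvgD; [apply: cvgZr_tmp; exact: cvg_id|exact: cvg_cst].
  by rewrite scale0r add0r.
have : \forall h \near (0 : R), U (h *: delta_mx 0 0 + p) /\
  W (Om (h *: delta_mx 0 0 + p)) := lc _ UW.
apply: filterS => h [Uh Wh]; apply/(Mf _ Wh)/(MU _ Uh).
(* Moving in the u direction leaves the coordinate v unchanged, so the point stays on the curve
   contained in [M]. *)
by rewrite !mxE /= mulr0 add0r.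
Qed.

Lemma not_free_orthonormal (N T x : 'rV[R]_4) :
  dot N N = 1 -> dot T T = 1 -> dot N T = 0 -> dot x T = 0 ->
  ~~ free [:: N; T; x] -> x = dot x N *: N.
Proof.
move=> NN TT NT xT; apply: contraNeq => xN.
apply/(@freeP _ _ 3 [tuple N; T; x]) => a.
rewrite !big_ord_recl big_ord0 /= addr0 => E.
have aT : a (lift ord0 ord0) = 0.
  have := congr1 (fun z => dot z T) E.
  by rewrite /= !dotDl !dotZl NT TT xT dot0l !mulr0 mulr1 add0r addr0.
have aN : a ord0 = - (a (lift ord0 (lift ord0 ord0)) * dot x N).
  have := congr1 (fun z => dot z N) E.
  rewrite /= aT scale0r add0r !dotDl !dotZl NN dot0l mulr1 => /eqP.
  by rewrite addr_eq0 => /eqP.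
(* Pairing with T and N has reduced the relation to a multiple of x - <x, N> N, which is nonzero by
   assumption. *)
have ax : a (lift ord0 (lift ord0 ord0)) = 0.
  apply/eqP; move: E; rewrite aN aT scale0r add0r scaleNr -scalerA addrC.
  rewrite -scalerBr => /eqP; rewrite scaler_eq0 subr_eq0 (negbTE xN) orbF.
  by [].
case=> [[|[|[|//]]]] Hi.
- by rewrite (_ : Ordinal Hi = ord0) ?aN ?ax ?mul0r ?oppr0 //; exact/val_inj.
- by rewrite (_ : Ordinal Hi = lift ord0 ord0) //; exact/val_inj.
- by rewrite (_ : Ordinal Hi = lift ord0 (lift ord0 ord0)) //; exact/val_inj.
Qed.

End Normal.

(** * The ED frame of a Betchov-Da Rios surface and its mean curvature *)

Section BetchovDaRios.
Variables (R : realType) (U : set 'rV[R]_2) (Om N : 'rV[R]_2 -> 'rV[R]_4).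
Hypotheses (oU : open U) (cOm : class_C 7 U Om) (cN : class_C 5 U N)
  (bdr : forall p, U p -> pd_v Om p
     = cross (pd_u Om p) (pd_u (pd_u Om) p) (pd_u (pd_u (pd_u Om)) p))
  (unit_speed : forall p, U p -> enorm (pd_u Om p) = 1)
  (NN : forall p, U p -> dot (N p) (N p) = 1)
  (NT : forall p, U p -> dot (N p) (frameT Om p) = 0)
  (second_case : forall p, U p ->
     ~~ free [:: N p; frameT Om p; pd_u (pd_u Om) p])
  (preE0 : forall p, U p -> preE Om N p != 0).

Local Notation e0 := (delta_mx 0 0 : 'rV[R]_2).
Local Notation e1 := (delta_mx 0 1 : 'rV[R]_2).
Local Notation T := (frameT Om).
Local Notation E := (frameE Om N).
Local Notation D := (frameD Om N).
Local Notation k := (kappa Om N).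
Local Notation s := (sigma Om N).
Local Notation t := (tau Om N).

Let cT : class_C 6 U T := class_C_derive e0 cOm.
Let cTu : class_C 5 U (pd_u T) := class_C_derive e0 cT.
Let cTuu : class_C 4 U (pd_u (pd_u T)) := class_C_derive e0 cTu.

Let TT p : U p -> dot (T p) (T p) = 1.
Proof. by move=> Up; rewrite -enorm_sqr unit_speed // expr1n. Qed.

Lemma class_C_preE : class_C 4 U (preE Om N).
Proof.
have cN4 := class_CW (leqnSn 4) cN.
have cT4 := class_CW (leq_addl 2 4) cT.
have cNN := class_CZ oU (class_CN oU (class_C_dot oU cTuu cN4)) cN4.
have cTT := class_CZ oU (class_CN oU (class_C_dot oU cTuu cT4)) cT4.
apply: class_C_eq_on oU _ (class_CD oU (class_CD oU cTuu cNN) cTT) => x Ux.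
by rewrite /preE !scaleNr.
Qed.

Lemma class_C_frameE : class_C 4 U E.
Proof. exact: class_C_normalize oU preE0 class_C_preE. Qed.

Lemma class_C_frameD : class_C 4 U D.
Proof.
exact: class_C_cross oU (class_CW (leqnSn 4) cN) (class_CW (leq_addl 2 4) cT)
  class_C_frameE.
Qed.

Lemma class_C_kappa : class_C 5 U k.
Proof. exact: class_C_dot oU cTu cN. Qed.

Lemma class_C_sigma : class_C 3 U s.
Proof.
exact: class_C_dot oU (class_C_derive e0 class_C_frameE)
  (class_CW (leqnSn 3) class_C_frameD).
Qed.

Lemma class_C_tau : class_C 3 U t.
Proof.
exact: class_C_dot oU (class_C_derive e0 class_C_frameE)
  (class_CW (leq_addl 2 3) cN).
Qed.

Lemma preE_orth p : U p -> dot (preE Om N p) (N p) = 0 /\ dot (preE Om N p) (T p) = 0.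
Proof.
move=> Up; rewrite /preE; move: (NN Up) (TT Up) (NT Up).
move: (pd_u _ p) (N p) (T p) => a n e nn ee ne.
by split; rewrite !(dotDl, dotNl, dotZl) ?nn ?ee ?(dotC e n) ne; ring.
Qed.

Lemma frame_orthonormal p : U p -> orthonormal4 (T p) (E p) (D p) (N p).
Proof.
move=> Up; have [EN ET] := preE_orth Up.
have EN' : dot (E p) (N p) = 0 by rewrite dotZl EN mulr0.
have ET' : dot (E p) (T p) = 0 by rewrite dotZl ET mulr0.
have EE : dot (E p) (E p) = 1 by exact: dot_normalize (preE0 Up).
split; [split|split| | |] => //.
- exact: TT.
- rewrite dot_cross_cross EE EN' ET' NN // TT // (dotC (T p) (N p)) NT //.
  by rewrite (dotC (N p) (E p)) (dotC (T p) (E p)) EN' ET' /det3; ring.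
- exact: NN.
- by rewrite dotC.
- exact: dot_cross2.
- by rewrite dotC NT.
- exact: dot_cross3.
- by rewrite dotC dot_cross1.
Qed.

Let derive_cst (F G : 'rV[R]_2 -> 'rV[R]_4) k' m c p :
  (forall x, U x -> dot (F x) (G x) = c) -> class_C k'.+1 U F -> class_C m.+1 U G ->
  U p -> dot (pd_u F p) (G p) = - dot (F p) (pd_u G p).
Proof.
move=> FG cF cG Up; apply: derive_dot_cst oU FG Up _ _.
  exact: class_CW cF.
exact: class_CW cG.
Qed.

Let derive_self (F : 'rV[R]_2 -> 'rV[R]_4) m c p :
  (forall x, U x -> dot (F x) (F x) = c) -> class_C m.+1 U F ->
  U p -> dot (pd_u F p) (F p) = 0.
Proof.
by move=> FF cF Up; apply: derive_dot_self oU FF Up _; exact: class_CW cF.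
Qed.

Lemma frameT_u p : U p -> pd_u T p = k p *: N p.
Proof.
move=> Up; apply: (not_free_orthonormal (NN Up) (TT Up) (NT Up) _ (second_case Up)).
exact: derive_self TT cT Up.
Qed.

Lemma frameE_u p : U p -> pd_u E p = s p *: D p + t p *: N p.
Proof.
move=> Up; have fr := frame_orthonormal Up.
have [[_ EE DD NNp] [TE TD TN] ED EN DN] := fr.
have frE x : U x -> dot (E x) (E x) = 1 by move=> /frame_orthonormal[[]].
have frT x : U x -> dot (E x) (T x) = 0.
  by move=> /frame_orthonormal[_ [+ _ _] _ _ _]; rewrite dotC.
apply: (orthonormal4_ext fr); rewrite dot_comb.
- rewrite (derive_cst frT class_C_frameE cT Up) frameT_u // dotZr EN mulr0 oppr0.
  by rewrite (dotC (D p)) TD (dotC (N p)) TN !mulr0 addr0.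
- rewrite (dotC (D p)) ED (dotC (N p)) EN !mulr0 addr0.
  exact: derive_self frE class_C_frameE Up.
- by rewrite DD (dotC (N p)) DN mulr0 mulr1 addr0.
- by rewrite DN NNp mulr0 mulr1 add0r.
Qed.

Hypothesis k0 : forall p, U p -> k p != 0.

(** Orthonormality settles every component but the one along D. There [preE], a multiple of E, is
    orthogonal to D, while its D component equals k <N_u, D>; as k is nonzero, <N_u, D> = 0. *)
Lemma frameN_u p : U p -> pd_u N p = - k p *: T p + - t p *: E p.
Proof.
move=> Up; have fr := frame_orthonormal Up.
have [[TTp EE DD NNp] [TE TD TN] ED EN DN] := fr.
have frNE x : U x -> dot (N x) (E x) = 0.
  by move=> /frame_orthonormal[_ _ _ + _]; rewrite dotC.
have Tuu : pd_u (pd_u T) p = pd_u k p *: N p + k p *: pd_u N p.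
  have [_ <-] := is_deriveZ_fun (class_C_is_derive e0 class_C_kappa Up)
    (class_C_is_derive e0 cN Up).
  exact: derive_eq_on oU frameT_u Up.
(* preE is a combination of pd_u N, T and N. *)
have ND0 : dot (pd_u N p) (D p) = 0.
  have pED : dot (preE Om N p) (D p) = 0.
    move: ED; rewrite dotZl => /eqP; rewrite mulf_eq0 invr_eq0.
    by rewrite gt_eqF ?enorm_gt0 ?preE0 //= => /eqP.
  move: pED; rewrite /preE -[pd_u (pd_u (pd_u Om)) p]/(pd_u (pd_u T) p).
  rewrite Tuu.
  rewrite !(dotDl, dotNl, dotZl) (dotC (N p)) DN TD !mulr0 !subr0 add0r => /eqP.
  by rewrite mulf_eq0 (negbTE (k0 Up)) /= => /eqP.
apply: (orthonormal4_ext fr); rewrite dot_comb.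
- rewrite (derive_cst NT cN cT Up) frameT_u // dotZr NNp TTp (dotC (E p)) TE.
  by rewrite !mulr1 mulr0 addr0.
- rewrite (derive_cst frNE cN class_C_frameE Up) TE EE mulr0 add0r mulr1.
  by rewrite dotC.
- by rewrite ND0 TD ED !mulr0 addr0.
- rewrite TN EN !mulr0 addr0.
  exact: derive_self NN cN Up.
Qed.

Lemma frameD_u p : U p -> pd_u D p = - s p *: E p.
Proof.
move=> Up; have fr := frame_orthonormal Up.
have [[TTp EE DD NNp] [TE TD TN] ED EN DN] := fr.
have frDD x : U x -> dot (D x) (D x) = 1 by move=> /frame_orthonormal[[]].
have frDT x : U x -> dot (D x) (T x) = 0.
  by move=> /frame_orthonormal[_ [_ + _] _ _ _]; rewrite dotC.
have frDE x : U x -> dot (D x) (E x) = 0.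
  by move=> /frame_orthonormal[_ _ + _ _]; rewrite dotC.
have frDN x : U x -> dot (D x) (N x) = 0 by move=> /frame_orthonormal[].
apply: (orthonormal4_ext fr); rewrite (dotZl (- s p) (E p)).
- rewrite (derive_cst frDT class_C_frameD cT Up) frameT_u // dotZr DN.
  by rewrite (dotC (E p)) TE !mulr0 oppr0.
- rewrite (derive_cst frDE class_C_frameD class_C_frameE Up) frameE_u //.
  by rewrite dot_combr DD DN EE mulr0 addr0 !mulr1.
- rewrite ED mulr0.
  exact: derive_self frDD class_C_frameD Up.
- rewrite (derive_cst frDN class_C_frameD cN Up) frameN_u //.
  by rewrite dot_combr (dotC (D p)) TD (dotC (D p)) ED EN !mulr0 addr0 oppr0.
Qed.

Lemma surface_v p : U p -> pd_v Om p = (k p ^+ 2 * t p) *: D p.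
Proof.
move=> Up; rewrite bdr // -[pd_u Om]/T.
(* In T x T_u x T_uu with T_u = k N, only the E coefficient - k t of T_uu survives; the sign in
   [cross_lin] makes the product k^2 t D. *)
have -> : pd_u (pd_u T) p = pd_u k p *: N p + (- (k p ^+ 2)) *: T p
    + (- (k p * t p)) *: E p.
  have hk : is_derive p e0 k (pd_u k p) := class_C_is_derive e0 class_C_kappa Up.
  have hN : is_derive p e0 N (- k p *: T p + - t p *: E p).
    by rewrite -frameN_u //; exact: class_C_is_derive e0 cN Up.
  have [_ H] := is_deriveZ_fun hk hN.
  apply: (etrans (derive_eq_on e0 oU frameT_u Up)); rewrite H.
  move: (T p) (E p) (N p) => x y z.
  by rewrite scalerDr !scalerA addrA !mulrN expr2.
by rewrite frameT_u // cross_lin; congr (_ *: _); ring.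
Qed.

Lemma frameT_v p : U p ->
  pd_v T p = pd_u (fun x => (k x ^+ 2 * t x) *: D x) p.
Proof.
move=> Up.
apply: (etrans (derive_comm_row e1 e0 oU (class_CW (leq_addl 5 2) cOm) Up)).
exact: derive_eq_on oU surface_v Up.
Qed.

Hypothesis t0 : forall p, U p -> t p != 0.

Let cT2 := class_CW (leq_addl 4 2) cT.
Let cE1 := class_CW (leq_addl 3 1) class_C_frameE.
Let cD1 := class_CW (leq_addl 3 1) class_C_frameD.
Let cN2 := class_CW (leq_addl 3 2) cN.
Let ck3 := class_CW (leq_addl 2 3) class_C_kappa.
Let cs1 := class_CW (leq_addl 2 1) class_C_sigma.

Lemma a34E p : U p -> dot (pd_v N p) (D p) = - a34 Om N p.
Proof.
exact: (frame_a34 oU frame_orthonormal cT2 cE1 cD1 cN2 ck3 cs1 class_C_tau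
  frameT_u frameE_u frameD_u frameT_v k0).
Qed.

Lemma a23E p : U p -> dot (pd_v E p) (D p) = a23 Om N p.
Proof.
exact: (frame_a23 oU frame_orthonormal cT2 cE1 cD1 cN2 ck3 cs1 class_C_tau
  frameT_u frameE_u frameD_u frameN_u frameT_v k0 t0).
Qed.

(** As E and N are orthonormal, both traces must vanish. They are - a23 / f and k + a34 / f with f =
    k^2 t nonzero, and the second vanishes exactly when a34 = - k f. The equivalence already holds
    point by point. *)
Lemma mean_curvature_eq0 p : U p -> mean_curvature Om E N p = 0 <->
  a23 Om N p = 0 /\ a34 Om N p = - (k p ^+ 3 * t p).
Proof.
move=> Up; have [[TTp EE DD NNp] [TE TD TN] ED EN DN] := frame_orthonormal Up.
have f0 : k p ^+ 2 * t p != 0 := mulf_neq0 (expf_neq0 2 (k0 Up)) (t0 Up).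
have dOm := class_C_differentiable cOm Up.
have uE : dot (pd_u E p) (T p) = 0.
  rewrite frameE_u // dot_comb (dotC (D p)) TD.
  by rewrite (dotC (N p)) TN !mulr0 addr0.
have uN : dot (pd_u N p) (T p) = - k p.
  rewrite frameN_u // dot_comb TTp (dotC (E p)) TE.
  by rewrite mulr0 addr0 mulr1.
have trE : \tr (shape_matrix Om E p) = - (0 + a23 Om N p / (k p ^+ 2 * t p)).
  apply: (etrans (tr_shape_matrix dOm
    (class_C_differentiable class_C_frameE Up) f0 TTp TD DD (surface_v Up))).
  by congr (- (_ + _ / _)); [exact: uE|exact: a23E].
have trN : \tr (shape_matrix Om N p) = - (- k p + - a34 Om N p / (k p ^+ 2 * t p)).
  apply: (etrans (tr_shape_matrix dOm
    (class_C_differentiable cN Up) f0 TTp TD DD (surface_v Up))).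
  by congr (- (_ + _ / _)); [exact: uN|exact: a34E].
have -> : mean_curvature Om E N p = 2^-1 *:
    (- (0 + a23 Om N p / (k p ^+ 2 * t p)) *: E p
     + - (- k p + - a34 Om N p / (k p ^+ 2 * t p)) *: N p).
  exact: (f_equal2 (fun a b : R => 2^-1 *: (a *: E p + b *: N p)) trE trN).
move: f0 (k0 Up) (t0 Up) EE NNp EN.
move: (a23 _ _ _) (a34 _ _ _) (k p) (t p) (E p) (N p).
move=> A B K S x y f0 K0 S0 xx yy xy; rewrite add0r.
split=> [/eqP|[-> ->]].
  rewrite scaler_eq0 invr_eq0 pnatr_eq0 /= => /eqP H.
  have HE := congr1 (fun z => dot z x) H.
  have HN := congr1 (fun z => dot z y) H.
  move: HE HN; rewrite /= !dot_comb !dot0l xx yy xy (dotC y) xy.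
  rewrite !mulr0 !mulr1 addr0 add0r => /eqP HE /eqP HN; split.
    by move: HE; rewrite oppr_eq0 mulf_eq0 invr_eq0 (negbTE f0) orbF => /eqP.
  move: HN; rewrite oppr_eq0 mulNr -opprD oppr_eq0 addrC addr_eq0 => /eqP BE.
  by rewrite -[B](divfK f0) BE; ring.
rewrite mul0r oppr0 scale0r add0r.
have -> : - (- K + - - (K ^+ 3 * S) / (K ^+ 2 * S)) = 0.
  by field; rewrite K0 S0.
by rewrite scale0r scaler0.
Qed.

End BetchovDaRios.

Theorem theorem6 (R : realType) (U : set 'rV[R]_2)
    (Om N : 'rV[R]_2 -> 'rV[R]_4)
    (openU : open U)
    (smooth_Om : class_C 7 U Om)
    (smooth_N : class_C 5 U N)
    (betchov_da_rios : forall p, U p ->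
       pd_v Om p
       = cross (pd_u Om p) (pd_u (pd_u Om) p) (pd_u (pd_u (pd_u Om)) p))
    (unit_speed : forall p, U p -> enorm (pd_u Om p) = 1)
    (on_hypersurface : forall v : R,
       exists (M : set 'rV[R]_4) (nu : 'rV[R]_4 -> 'rV[R]_4),
         oriented_hypersurface M nu /\
         (forall p, U p -> p 0 1 = v -> M (Om p) /\ N p = nu (Om p)))
    (second_case : forall p, U p ->
       ~~ free [:: N p; frameT Om p; pd_u (pd_u Om) p])
    (preE_neq0 : forall p, U p -> preE Om N p != 0)
    (kappa_neq0 : forall p, U p -> kappa Om N p != 0)
    (tau_neq0 : forall p, U p -> tau Om N p != 0) :
  (forall p, U p -> mean_curvature Om (frameE Om N) N p = 0)
  <->
  ((forall p, U p -> a23 Om N p = 0) /\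
   (forall p, U p -> a34 Om N p = - (kappa Om N p ^+ 3 * tau Om N p))).
Proof.
have NnuE p (Up : U p) :
    dot (N p) (N p) = 1 /\ dot (N p) (frameT Om p) = 0.
  (* The hypersurface may change with v, so the one attached to the u-curve through p is used. *)
  have [M [nu [hM MN]]] := on_hypersurface (p 0 1).
  have [_ ->] := MN p Up erefl.
  apply: (oriented_hypersurface_normal openU Up _ hM) => [|q Uq qp].
    exact: class_C_differentiable smooth_Om Up.
  by have [] := MN q Uq qp.
have H p (Up : U p) := mean_curvature_eq0 openU smooth_Om smooth_N betchov_da_rios
  unit_speed (fun p Up => (NnuE p Up).1) (fun p Up => (NnuE p Up).2) second_case
  preE_neq0 kappa_neq0 tau_neq0 Up.
split=> [mc0|[a0 a1] p Up].
  by split=> p Up; have [] := (H p Up).1 (mc0 p Up).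
by apply/(H p Up); split; [exact: a0|exact: a1].
Qed.
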